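(* Let $G$ be a connected claw-free graph on $n\geq 18$ vertices. If $q(G)\geq q(EN_n)$, then $G$ is traceable unless $G\cong EN_n$.
   Context: All graphs are finite and simple. A graph is claw-free if it has no induced subgraph isomorphic to $K_{1,3}$; it is traceable if it has a Hamilton path. For a graph $H$ with adjacency matrix $A$ and diagonal degree matrix $D$, $q(H)$ is the largest eigenvalue of $D+A$. For $n\geq 6$, $EN_n$ is the graph obtained from a complete graph $K_{n-3}$ by choosing three distinct vertices of it and attaching to each a new pendant vertex (so $EN_n$ has $n$ vertices). *)

(* Defs.v *)
From HB Require Import structures.
From mathcomp Require Import all_boot all_order all_algebra.
From mathcomp Require Import boolp classical_sets reals.

Set Implicit Arguments.
Unset Strict Implicit.
Unset Printing Implicit Defensive.

Import Order.TTheory GRing.Theory Num.Theory.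

Local Open Scope ring_scope.

Record sgraph := SGraph {
  vertex :> finType;
  edge : rel vertex;
  edge_sym : symmetric edge;
  edge_irrefl : irreflexive edge
}.

Definition induced_subgraph (H G : sgraph) : Prop :=
  exists f : H -> G,
    injective f /\ forall x y : H, edge (f x) (f y) = edge x y.

Definition graph_iso (G H : sgraph) : Prop :=
  exists f : G -> H,
    bijective f /\ forall x y : G, edge (f x) (f y) = edge x y.

Definition Kb_edge (m n : nat) : rel ('I_m + 'I_n)%type :=
  fun x y => is_inl x != is_inl y.

Lemma Kb_edge_sym m n : symmetric (@Kb_edge m n).
Proof. by move=> x y; rewrite /Kb_edge eq_sym. Qed.

Lemma Kb_edge_irrefl m n : irreflexive (@Kb_edge m n).
Proof. by move=> x; rewrite /Kb_edge eqxx. Qed.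

Definition complete_bipartite (m n : nat) : sgraph :=
  SGraph (@Kb_edge_sym m n) (@Kb_edge_irrefl m n).

Definition claw_free (G : sgraph) : Prop :=
  ~ induced_subgraph (complete_bipartite 1 3) G.

(* The empty graph counts as connected. *)
Definition connected_graph (G : sgraph) : Prop :=
  forall x y : G, connect (@edge G) x y.

Definition traceable (G : sgraph) : Prop :=
  exists (x : G) (p : seq G),
    [/\ path (@edge G) x p, uniq (x :: p) & forall y : G, y \in x :: p].

Definition degree (G : sgraph) (x : G) : nat := #|[set y : G | edge x y]|.

(* Rows and columns follow the enumeration enum_val of the vertices. *)
Definition adjacency_mx (R : realType) (G : sgraph) : 'M[R]_#|G| :=
  \matrix_(i, j) (edge (enum_val i) (enum_val j))%:R.

Definition degree_mx (R : realType) (G : sgraph) : 'M[R]_#|G| :=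
  diag_mx (\row_i (degree (enum_val i))%:R).

(* For a nonempty graph the set of real eigenvalues of this real symmetric
   matrix is finite and nonempty, so its supremum is its largest element. *)
Definition q_index (R : realType) (G : sgraph) : R :=
  sup [set a : R | eigenvalue (degree_mx R G + adjacency_mx R G) a]%classic.

(* The vertices i < n - 3 form the complete graph; for n >= 6 the vertices
   n - 3, n - 2, n - 1 are pendant, attached to 0, 1, 2 respectively. *)
Definition EN_edge (n : nat) : rel 'I_n := fun i j =>
  (i != j) && [|| (i < n - 3)%N && (j < n - 3)%N,
                  j == (i + (n - 3))%N :> nat
                | i == (j + (n - 3))%N :> nat].

Lemma EN_edge_sym n : symmetric (@EN_edge n).
Proof. by move=> i j; rewrite /EN_edge eq_sym andbC [X in _ || X]orbC andbC
  [X in X || _]andbC. Qed.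

Lemma EN_edge_irrefl n : irreflexive (@EN_edge n).
Proof. by move=> i; rewrite /EN_edge eqxx. Qed.

Definition EN (n : nat) : sgraph :=
  SGraph (@EN_edge_sym n) (@EN_edge_irrefl n).

(* Main.v *)
Require Import Defs.
From mathcomp Require Import boolp classical_sets reals polyrcf.
From mathcomp Require Import all_boot all_order all_algebra.
From mathcomp Require Import zify ring lra.

Import Order.TTheory GRing.Theory Num.Theory.

Set Implicit Arguments.
Unset Strict Implicit.
Unset Printing Implicit Defensive.

(* Proof idea. An explicit positive eigenvector, constant on pendant, attached
   and remaining vertices, gives EN_n an eigenvalue b > 2n - 8 + 3/(n-1), so
   some eigenvalue a of G is at least b. Collatz-Wielandt with the degree vector
   turns this into sum deg >= (n-2)(n-5). If G is not traceable, the
   Bondy-Chvatal closure (adding edges uv with d(u) + d(v) >= n-1) stops at a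
   non-traceable graph, which yields t+1 vertices of degree at most t for some
   t <= (n-2)/2. Counting edges, with claw-freeness, forces t <= 2; a second
   round, closing only off two pendant vertices, gives three vertices of degree
   at most 2. The other vertices are then so dense that they may be completed
   to a clique, and claw-freeness leaves only three pendant vertices with
   distinct neighbours: G is a spanning subgraph of EN_n. Collatz-Wielandt with
   the eigenvector of EN_n gives a < b for a proper connected spanning subgraph. *)

(** * Closure for traceability *)

(** The closure changes the edges over a fixed vertex type, so the graph notions are restated for a
    bare relation. *)
Definition deg (T : finType) (e : rel T) (x : T) : nat := #|[set y | e x y]|.

(** With [cycle], one edge run back and forth is a Hamilton cycle on two vertices, as the cone over
    a one-vertex graph requires. *)
Definition hamiltonian_rel (T : finType) (e : rel T) : Prop :=
  exists c : seq T, [/\ cycle e c, uniq c & forall y, y \in c].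

Definition traceable_rel (T : finType) (e : rel T) : Prop :=
  exists (x : T) (p : seq T), [/\ path e x p, uniq (x :: p) & forall y, y \in x :: p].

Definition add_edge (T : finType) (e : rel T) (p r : T) : rel T :=
  fun u v => [|| e u v, (u == p) && (v == r) | (u == r) && (v == p)].

(** The largest graph reachable from [e] by adding edges between vertices outside [X]. *)
Definition complete_off (T : finType) (X : {set T}) (e : rel T) : rel T :=
  fun u v => e u v || [&& u != v, u \notin X & v \notin X].

Lemma traceable_sub (T : finType) (e e' : rel T) :
  subrel e e' -> traceable_rel e -> traceable_rel e'.
Proof. by move=> ee' [x [p [pp up fp]]]; exists x, p; split=> //; apply: sub_path pp. Qed.

Lemma deg_sub (T : finType) (e e' : rel T) x : subrel e e' -> deg e x <= deg e' x.
Proof. by move=> ee'; apply/subset_leq_card/subsetP=> y; rewrite !inE; apply: ee'. Qed.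

Lemma add_edge_sym (T : finType) (e : rel T) p r :
  symmetric e -> symmetric (add_edge e p r).
Proof.
move=> es u v; rewrite /add_edge es.
by rewrite [(u == p) && _]andbC [(u == r) && _]andbC [X in _ || X]orbC.
Qed.

Lemma add_edge_irrefl (T : finType) (e : rel T) p r :
  p != r -> irreflexive e -> irreflexive (add_edge e p r).
Proof.
move=> pr ei u; rewrite /add_edge ei /=.
by apply/norP; split; apply: contra pr => /andP[/eqP<- /eqP<-].
Qed.

(* The classical crossing argument: if x ~ z and y ~ u, where y is the end of the
   path and u, z are consecutive on it, reverse the part from z to y. *)
Lemma ham_path_close (T : finType) (e : rel T) x p :
  symmetric e -> irreflexive e ->
  path e x p -> uniq (x :: p) -> (forall y, y \in x :: p) ->
  #|T| <= deg e x + deg e (last x p) -> hamiltonian_rel e.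
Proof.
move=> es ei pp up fp le; set y := last x p in le.
pose s := x :: p.
(* [B] collects the cyclic successors of the neighbours of [y], so a common element of [A] and [B]
   is a crossing. *)
pose A := [set z | e x z]; pose B := next s @: [set u | e y u].
have cB : #|B| = deg e y by rewrite card_imset //; apply: can_inj (prev_next up).
have nextE u : next s u = nth x p (index u s) by rewrite next_nth fp.
have xA : x \notin A by rewrite inE ei.
(* The default value [x] of [nth] closes the path up: [x] is the successor of [y] alone, and [y] is
   not its own neighbour. *)
have xB : x \notin B.
  apply/imsetP=> -[u]; rewrite inE => eyu xu.
  have uy : u = y.
    apply: (can_inj (prev_next up)); rewrite -/s -xu nextE.
    by rewrite nth_default // /s /y index_last.
  by rewrite uy ei in eyu.
(* Both sets avoid [x]; if disjoint, they would have at most [#|T| - 1] elements together. *)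
have [z zA zB] : exists2 z, z \in A & z \in B.
  apply/exists_inP; apply: contraT => /exists_inPn dj.
  have sub : A :|: B \subset [set~ x].
    apply/subsetP=> z; rewrite !in_setU in_setC1 => /orP[] h; apply: contraTneq h => ->//.
  have := subset_leq_card sub; rewrite cardsC1.
  have -> : #|A :|: B| = #|A| + #|B|.
    rewrite cardsU; suff -> : A :&: B = set0 by rewrite cards0 subn0.
    apply/setP=> z; rewrite in_setI in_set0.
    by case: (boolP (z \in A)) => //= h; apply/negbTE/dj.
  rewrite cB -/(deg e x); have : 0 < #|T| by apply/card_gt0P; exists x.
  lia.
case/imsetP: zB => u; rewrite inE => eyu zE.
set i := index u s; rewrite nextE -/i in zE.
have ip : i < size p.
  rewrite ltnNge; apply: contraL zA => h; rewrite zE nth_default //.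
have pE : p = take i p ++ z :: drop i.+1 p.
  by rewrite zE -drop_nth // cat_take_drop.
have uE : last x (take i p) = u.
  rewrite (last_nth x) size_take ip.
  have -> : x :: take i p = take i.+1 s by [].
  by rewrite nth_take // nth_index.
move: pp up fp eyu; rewrite /y pE last_cat /=.
set p1 := take i p in uE *; set p2 := drop i.+1 p.
rewrite cat_path /= uE => /and3P[pp1 euz pp2] up fp eyu.
exists (x :: p1 ++ rev (z :: p2)); split.
- rewrite /= rcons_cat cat_path pp1 /= uE -rev_cons.
  have -> : rev (x :: z :: p2) = last z p2 :: rev (belast x (z :: p2)).
    by rewrite lastI rev_rcons.
  rewrite /= es eyu /=.
  have := rev_path e x (z :: p2); rewrite /= => ->.
  rewrite es; move: zA; rewrite inE es => -> /=.
  by rewrite (eq_path (e' := e)).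
- move: up; rewrite -!cat_cons => up; rewrite (perm_uniq (s2 := (x :: p1) ++ z :: p2)) //.
  by rewrite perm_cat2l perm_rev.
- move=> w; have := fp w; rewrite -!cat_cons !mem_cat mem_rev //.
Qed.

Lemma sub_path_off (T : finType) (e : rel T) p r x s :
  p \notin x :: s -> path (add_edge e p r) x s -> path e x s.
Proof.
elim: s x => //= y s IH x; rewrite !inE !negb_or => /and3P[px py ps] /andP[exy pys].
rewrite IH ?andbT // ?inE ?negb_or ?py //.
by move: exy; rewrite /add_edge eq_sym (negbTE px) /= [y == p]eq_sym (negbTE py) andbF orbF.
Qed.

(** Ore's argument: rotate the cycle to start at [p]. If it uses the new edge once, deleting that
    edge leaves a Hamilton path of [e] between [p] and [r], and [ham_path_close] applies. *)
Lemma hamiltonian_add_edge (T : finType) (e : rel T) p r :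
  symmetric e -> irreflexive e -> p != r -> #|T| <= deg e p + deg e r ->
  hamiltonian_rel (add_edge e p r) -> hamiltonian_rel e.
Proof.
move=> es ei pr le [c0 [cc0 uc0 fc0]].
case: (boolP (e p r)) => [epr|nepr].
  exists c0; split=> //; apply: sub_cycle cc0 => u v; rewrite /add_edge.
  by case/or3P=> // /andP[/eqP-> /eqP->] //; rewrite es.
case: (rot_to (fc0 p)) => i c cE.
have cc : cycle (add_edge e p r) (p :: c) by rewrite -cE rot_cycle.
have uc : uniq (p :: c) by rewrite -cE rot_uniq.
have fc y : y \in p :: c by rewrite -cE mem_rot.
clear cE cc0 uc0 fc0.
have addp h : h != p -> add_edge e p r p h -> e p h || (h == r).
  by move=> hp; rewrite /add_edge eqxx (negbTE pr) /= orbF.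
case: c cc uc fc => [_ _ fc|h c]; first by have := fc r; rewrite inE eq_sym (negbTE pr).
rewrite [cycle _ _]/= rcons_path => /and3P[eph ph elp] uc fc.
have pnh : p \notin h :: c by case/andP: uc.
have ph' : path e h c by apply: sub_path_off ph.
have hp : h != p by apply: contraNneq pnh => ->; rewrite inE eqxx.
have lp : last h c != p by apply: contraNneq pnh => <-; rewrite mem_last.
have elp' : e p (last h c) || (last h c == r).
  by apply: addp => //; rewrite add_edge_sym.
case/orP: (addp _ hp eph) => [eph'|/eqP hr].
  case/orP: elp' => [elp'|/eqP lr].
    exists (p :: h :: c); split=> //.
    by rewrite [cycle _ _]/= rcons_path eph' ph' es.
  apply: (@ham_path_close _ e p (h :: c)) => //; first by rewrite /= eph'.
  by rewrite /= lr.
case/orP: elp' => [elp'|/eqP lr].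
  have perm : perm_eq (h :: rcons c p) (p :: h :: c).
    by rewrite -rcons_cons perm_rcons.
  apply: (@ham_path_close _ e h (rcons c p)) => //.
  - by rewrite rcons_path ph' es.
  - by rewrite (perm_uniq perm).
  - by move=> y; rewrite (perm_mem perm).
  - by rewrite last_rcons hr addnC.
(* Both cycle edges at [p] now lead to [r]. Either [p] and [r] are the only vertices, and their
   degrees are 0, or [r] occurs twice. *)
case: c lr uc fc {ph pnh ph' elp lp} => [|h2 c] lr uc fc.
  have z (q : T) : q \in [:: p; r] -> deg e q = 0.
    move=> qin; apply: eq_card0 => y; rewrite inE.
    have := fc y; rewrite hr !inE; move: qin; rewrite !inE.
    by case/orP=> /eqP-> /orP[]/eqP->; rewrite ?inE ?ei ?(negbTE nepr) // es (negbTE nepr).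
  move: le; rewrite !z ?inE ?eqxx ?orbT // leqn0 => /eqP T0.
  by have := fintype0 p T0.
move: uc; rewrite /= => /and3P[_ hn _].
by move: hn; rewrite hr -lr /= mem_last.
Qed.

(* A Hamilton path of [e] is a Hamilton cycle of its cone, cut at the apex [None]. *)
Definition cone (T : finType) (e : rel T) : rel (option T) :=
  fun u v => match u, v with
             | Some a, Some b => e a b
             | None, None => false
             | _, _ => true
             end.

Lemma path_cone_Some (T : finType) (e : rel T) x p :
  path (cone e) (Some x) (map Some p) = path e x p.
Proof. by elim: p x => //= y p IH x; rewrite IH. Qed.

Lemma traceable_cone (T : finType) (e : rel T) :
  0 < #|T| -> traceable_rel e <-> hamiltonian_rel (cone e).
Proof.
move=> T0; split.
  case=> x [p [pp up fp]]; exists (None :: map Some (x :: p)); split.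
  - by rewrite /= rcons_path path_cone_Some pp last_map.
  - rewrite cons_uniq map_inj_uniq ?up ?andbT; last by move=> ? ? [].
    by apply/mapP=> -[].
  - case=> [y|]; rewrite in_cons //.
    exact: (map_f Some (fp y)).
case=> c0 [cc0 uc0 fc0].
case: (rot_to (fc0 None)) => i c cE.
have cc : cycle (cone e) (None :: c) by rewrite -cE rot_cycle.
have uc : uniq (None :: c) by rewrite -cE rot_uniq.
have fc y : y \in None :: c by rewrite -cE mem_rot.
have [s sE] : exists s, c = map Some s.
  have : None \notin c by case/andP: uc.
  elim: (c) => [_|[a|] c' IH]; first by exists [::].
  - by rewrite inE /= => /IH[s ->]; exists (a :: s).
  - by rewrite inE eqxx.
have fs y : y \in s.
  by have := fc (Some y); rewrite inE sE /= mem_map // => ? ? [].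
case: s sE fs => [_ fs|x p sE fs]; first by case/card_gt0P: T0 => y _; have := fs y.
exists x, p; split=> //.
  by move: cc; rewrite sE /= rcons_path path_cone_Some => /andP[].
by move: uc; rewrite sE cons_uniq map_inj_uniq => [/andP[]|? ? []].
Qed.

Lemma deg_cone (T : finType) (e : rel T) x : deg (cone e) (Some x) = (deg e x).+1.
Proof.
rewrite /deg; have -> : [set y | cone e (Some x) y] = None |: Some @: [set y | e x y].
  apply/setP=> -[y|]; rewrite !inE //= mem_imset ?inE //; exact: Some_inj.
rewrite cardsU1 card_imset; last exact: Some_inj.
by case: imsetP => // -[].
Qed.

(** In the cone the order and both degrees grow by 1, which turns Ore's threshold n into n - 1 for
    paths. *)
Lemma traceable_add_edge (T : finType) (e : rel T) p r :
  symmetric e -> irreflexive e -> p != r -> #|T| <= (deg e p + deg e r).+1 ->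
  traceable_rel (add_edge e p r) -> traceable_rel e.
Proof.
move=> es ei pr le; have T0 : 0 < #|T| by apply/card_gt0P; exists p.
move/(traceable_cone _ T0) => [c [cc uc fc]]; apply/(traceable_cone _ T0).
apply: (@hamiltonian_add_edge _ _ (Some p) (Some r)).
- by move=> [a|] [b|] //=.
- by move=> [a|] //=.
- by [].
- by rewrite !deg_cone card_option; lia.
- exists c; split=> //; apply: sub_cycle cc => -[a|] [b|] //=.
Qed.

(** Bondy-Chvatal closure restricted to pairs outside [X], by induction on the number of
    non-adjacent ordered pairs. The final graph is still not traceable, so it cannot contain
    [complete_off X e] and misses a pair outside [X]. *)
Lemma traceable_saturate (T : finType) (X : {set T}) (e : rel T) :
  symmetric e -> irreflexive e -> ~ traceable_rel e ->
  traceable_rel (complete_off X e) ->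
  exists e' : rel T, [/\ symmetric e', irreflexive e', subrel e e',
    exists p r, [/\ p \notin X, r \notin X, p != r & ~~ e' p r] &
    forall p r : T, p \notin X -> r \notin X -> p != r -> ~~ e' p r ->
      deg e' p + deg e' r + 2 <= #|T|].
Proof.
pose N (e : rel T) := #|[set u : T * T | ~~ e u.1 u.2]|.
have [k] := ubnP (N e); elim: k e => // k IH e Nk es ei nt tX.
case: (boolP [exists u : T * T, [&& u.1 \notin X, u.2 \notin X, u.1 != u.2, ~~ e u.1 u.2
     & #|T| <= (deg e u.1 + deg e u.2).+1]]) => [/existsP[[p r] /=]|/existsPn H].
  case/and5P=> pX rX pr npr le.
  have sub : subrel e (add_edge e p r) by move=> u v h; rewrite /add_edge h.
  case: (IH (add_edge e p r)).
  - rewrite -ltnS; apply: leq_trans Nk; rewrite ltnS; apply: proper_card; apply/properP; split.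
      by apply/subsetP=> u; rewrite !inE; apply: contra; apply: sub.
    by exists (p, r); rewrite !inE //= /add_edge !eqxx orbT.
  - exact: add_edge_sym.
  - exact: add_edge_irrefl.
  - by move=> h; apply: nt; apply: traceable_add_edge h.
  - apply: traceable_sub tX => u v; rewrite /complete_off => /orP[/sub->//|->].
    by rewrite orbT.
  - move=> e' [s' i' sub' ex al]; exists e'; split=> // u v h.
    by apply: sub'; apply: sub.
exists e; split=> //.
  case: (boolP [exists u : T * T, [&& u.1 \notin X, u.2 \notin X, u.1 != u.2 & ~~ e u.1 u.2]])
     => [/existsP[[p r] /and4P[/= *]]|/existsPn H2]; first by exists p, r.
  case: nt; apply: traceable_sub tX => u v; rewrite /complete_off => /orP[//|/and3P[uv uX vX]].
  by have := H2 (u, v); rewrite /= uX vX uv /= negbK.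
move=> p r pX rX pr npr; have := H (p, r); rewrite /= pX rX pr npr /=; lia.
Qed.

(** Chvatal's argument in the closure [e']: take a missing pair [p], [r] outside [X] of maximal
    degree sum with [deg e' p <= deg e' r], let [t] be the degree of [p] and [L] the non-neighbours
    of [r] other than [r]. Maximality bounds the degrees in [L] outside [X] by [t], and [L] has n -
    1 - d(r) > t elements. Degrees in [e] are no larger than in [e']. *)
Lemma low_degree_set (T : finType) (X : {set T}) (e : rel T) :
  symmetric e -> irreflexive e -> ~ traceable_rel e ->
  traceable_rel (complete_off X e) ->
  exists p r t (L : {set T}),
   [/\ [/\ p \notin X, r \notin X, p != r & ~~ e p r],
       deg e p + deg e r + 2 <= #|T|,
       2 * t + 2 <= #|T|, t < #|L| &
       p \in L /\ forall x, x \in L -> x \notin X -> deg e x <= t].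
Proof.
move=> es ei nt tX.
case: (traceable_saturate es ei nt tX) => e' [es' ei' sub [p0 [r0 [pX0 rX0 pr0 npr0]]] al].
pose P (u : T * T) := [&& u.1 \notin X, u.2 \notin X, u.1 != u.2 & ~~ e' u.1 u.2].
have P0 : P (p0, r0) by rewrite /P /= pX0 rX0 pr0 npr0.
have [[p1 r1] P1 mx1] := arg_maxnP (fun u => deg e' u.1 + deg e' u.2) P0.
have [p [r [Pr mx pler]]] : exists p r, [/\ P (p, r),
   forall u, P u -> deg e' u.1 + deg e' u.2 <= deg e' p + deg e' r & deg e' p <= deg e' r].
  case: (leqP (deg e' p1) (deg e' r1)) => h; first by exists p1, r1.
  exists r1, p1; split=> [|u Pu|].
  - by move: P1; rewrite /P /= [r1 == _]eq_sym es' => /and4P[-> -> -> ->].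
  - by rewrite [leqRHS]addnC; apply: mx1.
  - exact: ltnW.
case/and4P: (Pr) => /= pX rX pr npr.
have le : deg e' p + deg e' r + 2 <= #|T| := al _ _ pX rX pr npr.
exists p, r, (deg e' p), (~: (r |: [set v | e' r v])); split=> //.
- split=> //; apply: contra npr; exact: sub.
- by apply: leq_trans le; rewrite leq_add2r leq_add ?deg_sub.
- by apply: leq_trans le; rewrite leq_add2r mul2n -addnn leq_add2l.
- have := cardsC (r |: [set v | e' r v]).
  rewrite cardsU1 inE ei' -/(deg e' r) /= => h.
  by rewrite -(leq_add2l (1 + deg e' r)) h; apply: leq_trans le; clear; lia.
- split; first by rewrite !inE negb_or pr es' npr.
  move=> x; rewrite !inE negb_or => /andP[xr nrx] xX.
  have := mx (x, r); rewrite /P /= xX rX xr es' nrx => /(_ isT).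
  by rewrite leq_add2r; apply: leq_trans (deg_sub x sub).
Qed.

(** * Low-degree vertices in claw-free graphs *)

Definition claw_free_rel (T : finType) (e : rel T) : Prop :=
  forall u x y z, e u x -> e u y -> e u z -> x != y -> x != z -> y != z ->
    [|| e x y, e x z | e y z].

(** A sum of booleans, so that the edges between two sets can be counted from either side by
    exchanging sums. *)
Definition nbrs_in (T : finType) (e : rel T) (S : {set T}) (x : T) : nat :=
  \sum_(y in S) e x y.

Lemma deg_nbrs_in (T : finType) (e : rel T) (S : {set T}) x :
  deg e x = nbrs_in e S x + nbrs_in e (~: S) x.
Proof.
rewrite /deg /nbrs_in -sum1_card big_mkcond (bigID (mem S)) /=; congr (_ + _).
  by apply: eq_bigr => y _; rewrite inE; case: (e x y).
by apply: eq_big => y; rewrite !inE // => _; case: (e x y).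
Qed.

Lemma nbrs_in_card (T : finType) (e : rel T) (S : {set T}) x :
  nbrs_in e S x = #|[set y in S | e x y]|.
Proof.
rewrite /nbrs_in -sum1_card [LHS]big_mkcond [RHS]big_mkcond /=.
by apply: eq_bigr => y _; rewrite inE; case: (y \in S); case: (e x y).
Qed.

Lemma nbrs_in_subset (T : finType) (e : rel T) (S S' : {set T}) x :
  S \subset S' -> nbrs_in e S x <= nbrs_in e S' x.
Proof.
move=> SS; rewrite !nbrs_in_card; apply/subset_leq_card/subsetP=> y.
by rewrite !inE => /andP[/(subsetP SS)->].
Qed.

Lemma sum_nbrs_in_subset (T : finType) (e : rel T) (S S' : {set T}) :
  S \subset S' -> \sum_(x in S) nbrs_in e S x <= \sum_(x in S') nbrs_in e S' x.
Proof.
move=> SS; rewrite [leqRHS](big_setID S) /= (setIidPr SS); apply: leq_trans (leq_addr _ _).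
by apply: leq_sum => x _; apply: nbrs_in_subset.
Qed.

(** Let B be the complement of [L]. The left side is 4e(L) + 2e(L,B) + 2e(B), and twice the degree
    sum over [L] is 4e(L) + 2e(L,B); only 2e(B) is estimated. *)
Lemma sum_deg_split (T : finType) (e : rel T) (L : {set T}) :
  symmetric e -> irreflexive e ->
  \sum_x deg e x + \sum_(x in L) nbrs_in e L x
    <= 2 * (\sum_(x in L) deg e x) + #|~: L| * #|~: L|.-1.
Proof.
move=> es ei; rewrite (bigID (mem L)) /=.
have eC : \sum_(x | x \notin L) deg e x =
    \sum_(x in L) nbrs_in e (~: L) x + \sum_(x in ~: L) nbrs_in e (~: L) x.
  rewrite /nbrs_in exchange_big /=.
  rewrite (eq_bigl (fun x => x \in ~: L)); last by move=> x; rewrite !inE.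
  rewrite -big_split /=; apply: eq_bigr => x _; rewrite (deg_nbrs_in e L); congr (_ + _).
  by apply: eq_bigr => y _; rewrite es.
have eL : \sum_(x in L) deg e x =
    \sum_(x in L) nbrs_in e L x + \sum_(x in L) nbrs_in e (~: L) x.
  by rewrite -big_split; apply: eq_bigr => x _; apply: deg_nbrs_in.
have le2 : \sum_(x in ~: L) nbrs_in e (~: L) x <= #|~: L| * #|~: L|.-1.
  rewrite -sum_nat_const; apply: leq_sum => x xL.
  rewrite nbrs_in_card (cardsD1 x (~: L)) xL /=; apply/subset_leq_card/subsetP=> y.
  by rewrite !inE => /andP[-> exy]; rewrite andbT; apply: contraTneq exy => ->; rewrite ei.
lia.
Qed.

(** Among neighbours of [v] there is no independent triple. If every vertex of [S] has two
    neighbours in [S], the sum is at least 16. Otherwise some [x] has at most one, and its at least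
    six non-neighbours in [S] form a clique, giving at least 30. *)
Lemma claw_free_nbr_density (T : finType) (e : rel T) (v : T) (S : {set T}) :
  irreflexive e -> claw_free_rel e ->
  (forall x, x \in S -> e v x) -> 8 <= #|S| ->
  9 <= \sum_(x in S) nbrs_in e S x.
Proof.
move=> ei cf Sv S8.
case: (boolP [forall x in S, 2 <= nbrs_in e S x]) => [/forall_inP H|/forall_inPn[x xS]].
  have : \sum_(x in S) 2 <= \sum_(x in S) nbrs_in e S x by apply: leq_sum.
  by rewrite sum_nat_const; lia.
rewrite -ltnNge ltnS => dx.
pose M := [set y in S | (y != x) && ~~ e x y].
have MS : M \subset S by apply/subsetP=> y; rewrite inE => /andP[].
have cM : 6 <= #|M|.
  have sub : S \subset x |: ([set y in S | e x y] :|: M).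
    by apply/subsetP=> y yS; rewrite !inE yS; case: (y == x) => //=; case: (e x y).
  have := subset_leq_card sub; rewrite cardsU1.
  have := (leq_card_setU [set y in S | e x y] M).1.
  by move: dx S8; rewrite nbrs_in_card; case: (_ \notin _) => /=; lia.
apply: leq_trans (sum_nbrs_in_subset e MS).
have : \sum_(y in M) 5 <= \sum_(y in M) nbrs_in e M y.
  apply: leq_sum => y yM; rewrite nbrs_in_card.
  have -> : [set z in M | e y z] = M :\ y.
    apply/setP=> z; rewrite !inE; case: (eqVneq z y) => [->|zy]; first by rewrite ei andbF.
    case: (boolP (z \in S)) => //= zS; case: (boolP ((z != x) && _)) => //= /andP[zx nxz].
    move: yM; rewrite inE => /and3P[yS yx nxy].
    have := cf v x y z (Sv _ xS) (Sv _ yS) (Sv _ zS).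
    by rewrite [x == y]eq_sym yx [x == z]eq_sym zx [y == z]eq_sym zy (negbTE nxy) (negbTE nxz) /= => ->.
  by have := cardsD1 y M; rewrite yM; lia.
rewrite sum_nat_const; lia.
Qed.

(* Counting edges suffices except for (n, t) = (18, 8) and (20, 9), where a vertex
   adjacent to nearly all of [L] and claw-freeness produce edges inside [L]. *)
Lemma no_large_low_degree_set (T : finType) (e : rel T) (n t : nat) (L : {set T}) :
  symmetric e -> irreflexive e -> claw_free_rel e ->
  #|T| = n -> 18 <= n -> 3 <= t -> 2 * t + 2 <= n -> t < #|L| ->
  (forall x, x \in L -> deg e x <= t) -> \sum_x deg e x < (n - 2) * (n - 5).
Proof.
move=> es ei cf cT n18 t3 tn tL0 dL0; rewrite ltnNge; apply/negP => sumd.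
(* Shrink [L] to exactly [t + 1] vertices, to have exact cardinalities in the count. *)
have [s [us ss sL]] := card_geqP tL0.
pose L' := [set x in s]; have cL : #|L'| = t.+1 by rewrite cardsE (card_uniqP us).
have dL x : x \in L' -> deg e x <= t by rewrite inE => /sL; apply: dL0.
have cC : #|~: L'| = n - t.+1 by have := cardsC L'; rewrite cT cL; lia.
have le1 : \sum_(x in L') deg e x <= #|L'| * t.
  by rewrite -sum_nat_const; apply: leq_sum.
have := sum_deg_split L' es ei; move: le1; rewrite cL cC.
set E := \sum_(x in L') nbrs_in _ _ _ => le1 sp.
have E9 : 2 * t + 2 = n -> n <= 20 -> 9 <= E.
  move=> tn' n20.
  (* Otherwise the degree sum is at most 9*8 + 9*15 = 207 < 208 for n = 18, or 10*9 + 10*17 = 260 <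
     270 for n = 20. *)
  have [v vL dv] : exists2 v, v \notin L' & n - 2 <= deg e v.
    case: (boolP [exists v, (v \notin L') && (n - 2 <= deg e v)]) => [/existsP[v /andP[]]|/existsPn H].
      by exists v.
    move: sumd; rewrite leqNgt => /negP[]; rewrite (bigID (mem L')) /=.
    have h1 : \sum_(x in L') deg e x <= #|L'| * t.
      by rewrite -sum_nat_const; apply: leq_sum.
    have h2 : \sum_(x | x \notin L') deg e x <= #|~: L'| * (n - 3).
      rewrite -sum_nat_const (eq_bigl (fun x => x \in ~: L')); last by move=> x; rewrite !inE.
      by apply: leq_sum => x; rewrite in_setC => xL; have := H x; rewrite xL /=; lia.
    move: h1 h2; rewrite cL cC; have : t = 8 \/ t = 9 by lia.
    by case=> ?; subst t n; lia.
  (* [v] misses at most one other vertex, so it sees at least [t] of the [t + 1] vertices of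
     [L']. *)
  have cS : 8 <= #|[set x in L' | e v x]|.
    have sub : L' :|: [set x | e v x] \subset [set~ v].
      by apply/subsetP=> x; rewrite !inE => h; apply: contraTneq h => ->; rewrite negb_or ei -[_ \in s](in_set (mem s)) vL.
    have := subset_leq_card sub; rewrite cardsC1 cT cardsU cL -/(deg e v).
    have -> : L' :&: [set x | e v x] = [set x in L' | e v x] by apply/setP=> x; rewrite !inE.
    have : #|[set x in L' | e v x]| <= #|L'| by apply/subset_leq_card/subsetP=> x; rewrite inE => /andP[].
    by lia.
  apply: leq_trans (claw_free_nbr_density (v := v) ei cf _ cS) _.
    by move=> x; rewrite inE => /andP[].
  by apply: sum_nbrs_in_subset; apply/subsetP=> x; rewrite inE => /andP[].
have {sp} : (n - 2) * (n - 5) + E <= 2 * (t.+1 * t) + (n - t.+1) * (n - t.+1).-1.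
  by apply: leq_trans (leq_trans sp _); rewrite ?leq_add2r ?leq_mul.
(* The substitution t = s' + 3, n = k + s' + 5 removes the truncated subtractions; [2 * t + 2 <= n]
   becomes [s' + 3 <= k]. *)
have [s' tE] : exists s', t = s' + 3 by exists (t - 3); lia.
have [k nE] : exists k, n = k + s' + 5 by exists (n - s' - 5); lia.
have -> : n - 2 = k + s' + 3 by lia.
have -> : n - 5 = k + s' by lia.
have -> : n - t.+1 = k.+1 by lia.
have ks : s' + 3 <= k by lia.
rewrite tE => le.
have {}le : 2 * k * (s' + 1) + E <= s' * s' + 11 * s' + 24 by lia.
(* With k >= s' + 3 the inequality gives (s' - 6)(s' + 3) <= 0. *)
have s7 : s' < 7 by nia.
have {}E9 : k = s' + 3 -> s' <= 6 -> 9 <= E by move=> *; apply: E9; lia.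
have k13 : 13 <= k + s' by lia.
clear -le E9 ks s7 k13.
(* Only k = s' + 3 with s' = 5 or 6 survives without [E9]: there [le] reads 96 + E <= 104 and 126 +
   E <= 126, which 9 <= E refutes. *)
by do 7?[case: s' le E9 ks s7 k13 => [|s'] le E9 ks s7 k13; first by lia].
Qed.

(** * Finding three vertices of degree at most 2 *)

Lemma deg1_inj (T : finType) (e : rel T) x u v :
  deg e x <= 1 -> e x u -> e x v -> u = v.
Proof. by move=> /card_le1_eqP h eu ev; apply: h; rewrite inE. Qed.

Lemma deg2_inj (T : finType) (e : rel T) x u v w :
  deg e x <= 2 -> e x u -> e x v -> u != v -> e x w -> (w == u) || (w == v).
Proof.
move=> d eu ev uv ew; apply: contraT; rewrite negb_or => /andP[wu wv].
suff : 2 < deg e x by rewrite ltnNge d.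
by apply/card_gt2P; exists w, u, v; rewrite !inE; split; split=> //; rewrite eq_sym.
Qed.

Lemma connected_cut (T : finType) (e : rel T) (S : {set T}) (x y : T) :
  symmetric e -> connect e x y -> x \in S -> y \notin S ->
  exists u v, [/\ u \in S, v \notin S & e u v].
Proof.
move=> es cxy xS; case: (boolP [exists u, exists v, [&& u \in S, v \notin S & e u v]]).
  by case/existsP=> u /existsP[v /and3P[*]]; exists u, v.
move=> /existsPn H; rewrite -(@closed_connect _ e (mem S) _ x y cxy) ?xS //.
have cl u v : e u v -> u \in S -> v \in S.
  move=> euv uS; have := H u; rewrite negb_exists => /forallP /(_ v).
  by rewrite uS euv andbT negbK.
by move=> u v euv; apply/idP/idP; apply: cl; rewrite // es.
Qed.

Lemma connected_deg_gt0 (T : finType) (e : rel T) (x : T) :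
  symmetric e -> (forall u v, connect e u v) -> 1 < #|T| -> 0 < deg e x.
Proof.
move=> es con T1; have [y yx] : exists y, y != x.
  have := cardC1 x; case: (pickP (predC1 x)) => [y yx _|h]; first by exists y.
  by rewrite (eq_card0 h) => /esym/eqP; rewrite -subn1 subn_eq0 leqNgt T1.
have [|u [v [/set1P-> _ exv]]] := @connected_cut _ e [set x] x y es (con x y) (set11 x).
  by rewrite inE.
by apply/card_gt0P; exists v; rewrite inE.
Qed.

Lemma path_complete_off (T : finType) (X : {set T}) (e : rel T) x s :
  uniq (x :: s) -> (forall y, y \in x :: s -> y \notin X) -> path (complete_off X e) x s.
Proof.
elim: s x => //= y s IH x /andP[]; rewrite inE negb_or => /andP[xy _] us H.
rewrite IH // ?andbT => [|z zs]; last by apply: H; rewrite inE zs orbT.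
by rewrite /complete_off xy !H ?orbT // !inE eqxx ?orbT.
Qed.

(* The path enters the clique at [a], sweeps it and leaves it at [b]. *)
Lemma traceable_complete_off (T : finType) (X : {set T}) (e : rel T) a l1 b l2 :
  symmetric e -> a \notin X -> b \notin X ->
  path (complete_off X e) a l1 -> path (complete_off X e) b l2 ->
  uniq ((a :: l1) ++ (b :: l2)) ->
  (forall x, x \in X -> x \in (a :: l1) ++ (b :: l2)) ->
  traceable_rel (complete_off X e).
Proof.
move=> es aX bX p1 p2; set l := _ ++ _ => ul Xl.
set e' := complete_off X e in p1 p2 *.
have es' : symmetric e'.
  by move=> u v; rewrite /e' /complete_off es eq_sym [(u \notin X) && _]andbC.
pose mid := [seq w <- enum T | w \notin l].
have umid : uniq mid by rewrite filter_uniq ?enum_uniq.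
have midX w : w \in mid -> w \notin X.
  by rewrite mem_filter => /andP[wl _]; apply: contra wl; apply: Xl.
have midl w : w \in mid -> w \notin l by rewrite mem_filter => /andP[].
have ab : a != b.
  by move: ul; rewrite /l /= mem_cat inE !negb_or -!andbA => /and4P[].
have pm : path e' a (rcons mid b).
  apply: path_complete_off => [|y]; last first.
    by rewrite inE mem_rcons inE => /orP[/eqP->|/orP[/eqP->|/midX]].
  rewrite cons_uniq rcons_uniq umid mem_rcons inE negb_or ab /=.
  apply/and3P; split=> //; apply/negP=> /midl; rewrite /l mem_cat !inE eqxx //.
  by rewrite orbT.
have perm : perm_eq (rev (a :: l1) ++ mid ++ b :: l2) (l ++ mid).
  rewrite /l -catA; apply: perm_cat; first by rewrite perm_rev.
  by rewrite perm_catC.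
have pr : path e' (last a l1) (rev (belast a l1) ++ mid ++ b :: l2).
  rewrite cat_path; apply/andP; split.
    by rewrite rev_path (eq_path (e' := e')).
  have -> : last (last a l1) (rev (belast a l1)) = a.
    by case: (l1) => //= ? ?; rewrite rev_cons last_rcons.
  by rewrite -cat_rcons cat_path pm last_rcons.
have sE : rev (a :: l1) = last a l1 :: rev (belast a l1) by rewrite lastI rev_rcons.
exists (last a l1), (rev (belast a l1) ++ mid ++ b :: l2).
rewrite -cat_cons -sE; split=> //.
  rewrite (perm_uniq perm) cat_uniq ul umid andbT.
  by apply/hasPn=> w /midl.
move=> w; rewrite (perm_mem perm) mem_cat; case: (boolP (w \in l)) => //= wl.
by rewrite mem_filter wl mem_enum.
Qed.

(** The first round leaves t = 1 or t = 2, and t = 2 is immediate. If t = 1, two pendant vertices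
    are at hand; excluding them from the second closure makes it yield a low vertex [p'] different
    from both. *)
Lemma three_low_degree (T : finType) (e : rel T) (n : nat) :
  symmetric e -> irreflexive e -> claw_free_rel e -> (forall u v, connect e u v) ->
  #|T| = n -> 18 <= n -> (n - 2) * (n - 5) <= \sum_x deg e x ->
  ~ traceable_rel e ->
  exists x y z, [/\ uniq [:: x; y; z], deg e x <= 2, deg e y <= 2 & deg e z <= 2].
Proof.
move=> es ei cf con cT n18 sumd nt.
have dpos x : 0 < deg e x by apply: connected_deg_gt0; rewrite ?cT //; lia.
have nbr x : exists u, e x u.
  by have /card_gt0P[u] := dpos x; rewrite inE; exists u.
have big t (L : {set T}) : 2 * t + 2 <= n -> t < #|L| ->
    (forall x, x \in L -> deg e x <= t) -> t <= 2.
  move=> tn tL dL; rewrite leqNgt; apply/negP=> t3.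
  by have := no_large_low_degree_set es ei cf cT n18 t3 tn tL dL; rewrite ltnNge sumd.
have three (L : {set T}) : 2 < #|L| -> (forall x, x \in L -> deg e x <= 2) ->
    exists x y z, [/\ uniq [:: x; y; z], deg e x <= 2, deg e y <= 2 & deg e z <= 2].
  case/card_gt2P=> x [y [z [[xL yL zL] [xy yz zx]]]] dL; exists x, y, z; split; try exact: dL.
  by rewrite /= !inE negb_or xy yz eq_sym zx.
have t0 : traceable_rel (complete_off set0 e).
  have /card_gt1P[a [b [_ _ ab]]] : 1 < #|[set: T]| by rewrite cardsT cT; lia.
  by apply: (@traceable_complete_off _ _ _ a [::] b [::]) => [||||||x]; rewrite ?inE //= ?inE ?ab.
have [p [r [t [L [_ _ tn tL [pL dL]]]]]] := low_degree_set es ei nt t0.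
rewrite cT in tn.
have {}dL x : x \in L -> deg e x <= t by move=> xL; apply: dL; rewrite ?inE.
have := big _ _ tn tL dL.
have := leq_trans (dpos p) (dL _ pL).
case: t tn tL dL => [//|[|[|//]]] tn tL dL _ _; last exact: three tL dL.
case/card_gt1P: tL => x [y [/dL dx /dL dy xy]].
have [u exu] := nbr x; have [w eyw] := nbr y.
have out (S : {set T}) v : v \in S -> #|S| <= 3 -> exists u v, [/\ u \in S, v \notin S & e u v].
  move=> vS cS; have /card_gt0P[v' v'S] : 0 < #|~: S|.
    by have := cardsC S; rewrite cT; lia.
  by apply: (connected_cut es (con v v')) => //; rewrite -in_setC.
(* Two adjacent pendant vertices would form a whole component. *)
have nxy : ~~ e x y.
  apply/negP=> exy; have eyx : e y x by rewrite es.
  have [|v1 [v2 [v1S v2S e12]]] := out [set x; y] x (set21 _ _).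
    by rewrite cards2; case: (_ != _).
  case/set2P: v1S e12 v2S => -> e12; rewrite !inE negb_or => /andP[].
    by rewrite (deg1_inj dx e12 exy) eqxx.
  by rewrite (deg1_inj dy e12 eyx) eqxx.
(* A common neighbour [u] must have a further neighbour by connectedness, which makes a claw with
   [x] and [y]. *)
have uw : u != w.
  apply/negP=> /eqP uwE; subst w.
  have [||v1 [v2 [v1S v2S e12]]] := out [set x; y; u] x.
  - by rewrite !inE eqxx.
  - apply: leq_trans (leq_card_setU _ _).1 _.
    by rewrite cards1 cards2; case: (_ != _).
  move: v2S; rewrite !inE !negb_or -andbA => /and3P[v2x v2y v2u].
  have v1u : v1 = u.
    move: v1S; rewrite !inE -orbA => /or3P[]/eqP v1E //; subst v1.
      by rewrite (deg1_inj dx e12 exu) eqxx in v2u.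
    by rewrite (deg1_inj dy e12 eyw) eqxx in v2u.
  subst v1; have := cf u x y v2; rewrite es exu es eyw e12 (negbTE nxy) xy.
  rewrite [x == _]eq_sym [y == _]eq_sym v2x v2y /= => /(_ isT isT isT isT isT isT) /orP[h|h].
    by rewrite (deg1_inj dx h exu) eqxx in v2u.
  by rewrite (deg1_inj dy h eyw) eqxx in v2u.
have uy : u != y by apply: contraNneq nxy => <-.
have wx : w != x by apply: contraNneq nxy => <-; rewrite es.
have ux : u != x by apply: contraTneq exu => ->; rewrite ei.
have wy : w != y by apply: contraTneq eyw => ->; rewrite ei.
(* The path starts x, u, sweeps the clique and ends w, y. *)
have t2 : traceable_rel (complete_off [set x; y] e).
  apply: (@traceable_complete_off _ _ _ u [:: x] w [:: y]) => //=.
  - by rewrite !inE negb_or ux.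
  - by rewrite !inE negb_or wx.
  - by rewrite /complete_off es exu.
  - by rewrite /complete_off es eyw.
  - by rewrite !inE !negb_or ux uw uy [x == w]eq_sym wx xy wy.
  - by move=> z; rewrite !inE => /orP[]/eqP->; rewrite eqxx ?orbT.
have [p' [r' [t [L' [[p'X _ _ _] _ tn' tL' [p'L dL']]]]]] := low_degree_set es ei nt t2.
rewrite cT in tn'.
(* [low_degree_set] bounds degrees only outside [X]; since [t] is positive, the bound extends to the
   pendant vertices [x] and [y]. *)
have t1 : 0 < t by apply: leq_trans (dpos p') _; apply: dL'.
have {}dL' v : v \in L' -> deg e v <= t.
  move=> vL; case: (boolP (v \in [set x; y])) => [|/(dL' _ vL)//].
  by rewrite !inE => /orP[]/eqP->; apply: leq_trans t1.
have := big _ _ tn' tL' dL'.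
case: t t1 tn' tL' dL' => [//|[|[|//]]] _ tn' tL' dL' _; last exact: three tL' dL'.
exists x, y, p'; split; try exact: leqW.
  by move: p'X; rewrite /= !inE !negb_or xy => /andP[p'x p'y]; rewrite eq_sym p'x eq_sym p'y.
by apply: leqW; apply: dL'.
Qed.

(** An upper bound on the edge set: [e] lies inside the clique on the remaining vertices together
    with three pendant edges. *)
Definition pendants_attached (T : finType) (e : rel T) (x y z a b c : T) : Prop :=
  forall u v, e u v ->
    (u \notin [set x; y; z]) && (v \notin [set x; y; z]) ||
    ((u, v) \in [:: (x, a); (a, x); (y, b); (b, y); (z, c); (c, z)]).

(** * Structure around three vertices of degree at most 2 *)

Section ThreeLowDegree.

Variables (T : finType) (e : rel T) (n : nat).
Hypotheses (es : symmetric e) (ei : irreflexive e) (cf : claw_free_rel e).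
Hypotheses (con : forall u v, connect e u v) (cT : #|T| = n) (n18 : 18 <= n).
Hypothesis (sumd : (n - 2) * (n - 5) <= \sum_x deg e x).

Lemma sum_deg_low (s : seq T) :
  uniq s -> \sum_x deg e x <= 2 * (\sum_(x <- s) deg e x) + (n - size s) * (n - size s).-1.
Proof.
move=> us; have := sum_deg_split [set x in s] es ei.
have c : #|[set x in s]| = size s by rewrite cardsE (card_uniqP us).
have -> : #|~: [set x in s]| = n - size s.
  by have := cardsC [set x in s]; rewrite cT c; lia.
have -> : \sum_(x in [set x in s]) deg e x = \sum_(x <- s) deg e x.
  by rewrite big_uniq //=; apply: eq_bigl => x; rewrite inE.
by apply: leq_trans; apply: leq_addr.
Qed.

(** Counting with the four vertices [u], [x], [y], [z] gives deg u >= n - 11. *)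
Lemma deg_ge7 x y z u : uniq [:: x; y; z] -> deg e x <= 2 -> deg e y <= 2 -> deg e z <= 2 ->
  u \notin [set x; y; z] -> 7 <= deg e u.
Proof.
move=> us dx dy dz; rewrite !inE !negb_or -andbA => /and3P[ux uy uz].
have := @sum_deg_low [:: u; x; y; z]; rewrite cons_uniq us !inE !negb_or ux uy uz /=.
move=> /(_ isT); rewrite !big_cons big_nil => h.
by have := leq_trans sumd h; lia.
Qed.

(** If [s] and [s'] were not adjacent, they and their neighbours would be at most six vertices, so
    [u] would have a neighbour [w] beyond them and a claw on [s], [s'], [w]. *)
Lemma low_nbrs_adj u s s' : 7 <= deg e u -> deg e s <= 2 -> deg e s' <= 2 ->
  e u s -> e u s' -> s != s' -> e s s'.
Proof.
move=> du ds ds' us us' ss'; apply: contraT => nss'.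
pose B := [set s; s'] :|: ([set w | e s w] :|: [set w | e s' w]).
have cB : #|B| < deg e u.
  apply: leq_trans du; rewrite ltnS /B.
  apply: leq_trans (leq_card_setU _ _).1 _; rewrite cards2 ss'.
  by have := (leq_card_setU [set w | e s w] [set w | e s' w]).1; rewrite -!/(deg e _); lia.
have : ~~ ([set w | e u w] \subset B).
  by apply/negP=> /subset_leq_card; rewrite leqNgt cB.
case/subsetPn=> w; rewrite !inE !negb_or => uw /andP[/andP[ws ws'] /andP[sw sw']].
have := cf us us' uw ss'; rewrite eq_sym ws eq_sym ws' (negbTE nss') (negbTE sw) (negbTE sw').
by move=> /(_ isT isT).
Qed.

(** If not, the closure leaves a pair [p], [r] outside of degree sum at most n - 2. Counting with
    these five vertices gives 4(n - 5) <= 2(n + 4), hence n <= 14. *)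
Lemma traceable_of_complete_off x y z :
  uniq [:: x; y; z] -> deg e x <= 2 -> deg e y <= 2 -> deg e z <= 2 ->
  traceable_rel (complete_off [set x; y; z] e) -> traceable_rel e.
Proof.
move=> us dx dy dz tX; apply: contrapT => nt.
have [p [r [t [L [[pX rX pr _] le _ _ _]]]]] := low_degree_set es ei nt tX.
rewrite cT in le; move: pX rX; rewrite !inE !negb_or -!andbA => /and3P[px py pz] /and3P[rx ry rz].
have := @sum_deg_low [:: p; r; x; y; z].
rewrite !(cons_uniq p) !(cons_uniq r) us !inE !negb_or px py pz rx ry rz pr /=.
move=> /(_ isT); rewrite !big_cons big_nil => h.
by have := leq_trans sumd h; lia.
Qed.

Lemma deg_gt0 x : 0 < deg e x.
Proof. by apply: connected_deg_gt0; rewrite ?cT //; lia. Qed.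

Lemma ex_notin (s : seq T) : size s < n -> exists v, v \notin s.
Proof.
move=> sn; have : 0 < #|~: [set x in s]|.
  have h : #|[set x in s]| <= size s by rewrite cardsE card_size.
  by have := cardsC [set x in s]; rewrite cT; lia.
by case/card_gt0P=> v; rewrite !inE; exists v.
Qed.

Lemma cut_seq (s : seq T) x : x \in s -> size s < n ->
  exists u v, [/\ u \in s, v \notin s & e u v].
Proof.
move=> xs /ex_notin[y ys].
have [||u [v [uS vS euv]]] := @connected_cut _ e [set w in s] x y es (con x y); rewrite ?inE //.
by exists u, v; split=> //; [rewrite inE in uS | rewrite inE in vS].
Qed.

Section Config.

Variables x y z : T.
Hypotheses (us : uniq [:: x; y; z]).
Hypotheses (dx : deg e x <= 2) (dy : deg e y <= 2) (dz : deg e z <= 2).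

Let X := [set x; y; z].

Let inX v : (v \in X) = (v \in [:: x; y; z]).
Proof. by rewrite !inE orbA. Qed.

Let offE u v : e u v -> complete_off X e u v.
Proof. by rewrite /complete_off => ->. Qed.

(** The Hamilton path is z, y, x, v followed by the rest of the clique, ending at an arbitrary
    [b]. *)
Lemma path3_traceable v : v \notin X -> e v x -> e x y -> e y z -> traceable_rel e.
Proof.
move=> vX evx exy eyz; apply: (@traceable_of_complete_off x y z) => //.
have [b bv] : exists b, b \notin [:: v; x; y; z] by apply: ex_notin => /=; lia.
apply: (@traceable_complete_off _ _ _ v [:: x; y; z] b [::]) => //=.
- by apply: contra bv; rewrite -/X inX [in X in _ -> X]in_cons => ->; rewrite orbT.
- by rewrite !offE.
- move: us bv vX; rewrite inX /= !inE !negb_or; move=> /and3P[/andP[-> ->] -> _] /and4P[bv bx by_ bz].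
  by move=> /and3P[-> -> ->]; rewrite [v == b]eq_sym [x == b]eq_sym [y == b]eq_sym [z == b]eq_sym bv bx by_ bz.
- by move=> w; rewrite -/X inX !inE => /or3P[]->; rewrite ?orbT.
Qed.

(** The Hamilton path is y, x, v, the clique, d, z with [d] a neighbour of [z]. If [v] and [d]
    coincided, [low_nbrs_adj] would make [x] and [z] adjacent. *)
Lemma edge_apart_traceable v : ~~ e x z -> ~~ e y z -> e x y ->
  v \notin X -> e v x -> traceable_rel e.
Proof.
move=> nxz nyz exy vX evx; apply: (@traceable_of_complete_off x y z) => //.
have /card_gt0P[d] := deg_gt0 z; rewrite inE => ezd.
have dX : d \notin X.
  rewrite inX !inE !negb_or; apply/and3P; split; apply: contraTneq ezd => ->.
  - by rewrite es.
  - by rewrite es.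
  - by rewrite ei.
have vd : v != d.
  apply: contraNneq nxz => vd; apply: (@low_nbrs_adj v) => //.
  - exact: (@deg_ge7 x y z).
  - by rewrite vd es.
  - by move: us; rewrite /= !inE negb_or => /and3P[/andP[]].
apply: (@traceable_complete_off _ _ _ v [:: x; y] d [:: z]) => //=.
- by rewrite !offE.
- by rewrite offE // es.
- move: us dX vX; rewrite !inX /= !inE !negb_or.
  move=> /and3P[/andP[-> ->] -> _] /and3P[d_x d_y ->] /and3P[-> -> ->].
  by rewrite vd [x == d]eq_sym [y == d]eq_sym d_x d_y.
- by move=> w; rewrite -/X inX !inE => /or3P[]->; rewrite ?orbT.
Qed.

End Config.

(** By connectedness some edge leaves the low component. If two edges join the three vertices, use
    [path3_traceable]; if only [x] and [y] are joined, use [edge_apart_traceable]. *)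
Lemma low_edge_traceable x y z :
  uniq [:: x; y; z] -> deg e x <= 2 -> deg e y <= 2 -> deg e z <= 2 ->
  e x y -> traceable_rel e.
Proof.
have rot3 (p q r : T) : uniq [:: p; q; r] -> uniq [:: r; q; p] /\ uniq [:: q; p; r].
  rewrite /= !inE !negb_or => /and3P[/andP[pq pr] qr _].
  by rewrite [r == q]eq_sym [r == p]eq_sym [q == p]eq_sym qr pr pq.
have setE (p q r : T) : [set r; q; p] = [set p; q; r] /\ [set q; p; r] = [set p; q; r].
  by split; apply/setP=> w; rewrite !inE; case: (w == p); case: (w == q); case: (w == r).
have path3 p q r : uniq [:: p; q; r] -> deg e p <= 2 -> deg e q <= 2 -> deg e r <= 2 ->
    e p q -> e q r -> traceable_rel e.
  move=> us dp dq dr epq eqr.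
  have [||u [v [uS vS euv]]] := @cut_seq [:: p; q; r] p; rewrite ?inE ?eqxx //=; first by lia.
  have vX : v \notin [set p; q; r] by move: vS; rewrite !inE orbA.
  have pr : p != r by move: us; rewrite /= !inE negb_or => /andP[/andP[]].
  move: uS; rewrite !inE => /or3P[]/eqP uE; subst u.
  - by apply: (path3_traceable us dp dq dr vX) => //; rewrite es.
  (* The middle vertex [q] has spent its degree on [p] and [r], so the edge leaves from an end. *)
  - have := deg2_inj dq (_ : e q p) eqr pr euv; rewrite es epq => /(_ isT).
    by move: vS; rewrite !inE !negb_or => /and3P[/negbTE-> _ /negbTE->].
  - apply: (@path3_traceable r q p _ _ _ _ v) => //; try by rewrite es.
    + by have [] := rot3 _ _ _ us.
    + by rewrite (setE p q r).1.
move=> us dx dy dz exy.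
case: (boolP (e y z)) => [eyz|nyz]; first exact: (path3 _ _ _ us dx dy dz exy eyz).
have us' : uniq [:: y; x; z] by have [] := rot3 _ _ _ us.
case: (boolP (e x z)) => [exz|nxz]; first by apply: (path3 _ _ _ us' dy dx dz _ exz); rewrite es.
have [||u [v [uS vS euv]]] := @cut_seq [:: x; y] x; rewrite ?inE ?eqxx //=; first by lia.
have vX : v \notin [set x; y; z].
  move: vS; rewrite !inE !negb_or => /andP[-> ->] /=.
  apply: contraTneq euv => ->; move: uS; rewrite !inE => /orP[]/eqP->; exact/negbT/negbTE.
move: uS; rewrite !inE => /orP[]/eqP uE; subst u.
  by apply: (edge_apart_traceable us _ _ _ nxz nyz exy vX); rewrite // es.
apply: (@edge_apart_traceable y x z us' _ _ _ v nyz nxz); rewrite // ?(es y x) ?(es v) //.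
by rewrite (setE x y z).2.
Qed.

(** With [b] and [c] neighbours of [y] and [z], the path is y, b, the clique, a, x, a', c, z, where
    a'c is a clique edge. [low_nbrs_adj] keeps [b] and [c] apart from each other and from [a],
    [a']. *)
Lemma two_nbrs_traceable x y z a a' :
  uniq [:: x; y; z] -> deg e x <= 2 -> deg e y <= 2 -> deg e z <= 2 ->
  ~~ e x y -> ~~ e x z -> ~~ e y z -> e x a -> e x a' -> a != a' -> traceable_rel e.
Proof.
move=> us dx dy dz nxy nxz nyz exa exa' aa'.
have /card_gt0P[b] := deg_gt0 y; rewrite inE => eyb.
have /card_gt0P[c] := deg_gt0 z; rewrite inE => ezc.
have offX s v : s \in [:: x; y; z] -> e s v -> v \notin [set x; y; z].
  rewrite !inE -orbA => /or3P[]/eqP-> esv; apply: contraTN esv => /or3P[]/eqP->;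
  by rewrite ?ei // es.
have aX : a \notin [set x; y; z] by apply: offX exa; rewrite !inE eqxx.
have aX' : a' \notin [set x; y; z] by apply: offX exa'; rewrite !inE eqxx.
have bX : b \notin [set x; y; z] by apply: offX eyb; rewrite !inE eqxx orbT.
have cX : c \notin [set x; y; z] by apply: offX ezc; rewrite !inE eqxx !orbT.
have ne s s' v v' : s \in [:: x; y; z] -> s' \in [:: x; y; z] -> s != s' -> ~~ e s s' ->
    e s v -> e s' v' -> v != v'.
  move=> sX s'X ss' nss' esv es'v'; apply: contraNneq nss' => vv.
  have low w : w \in [:: x; y; z] -> deg e w <= 2 by rewrite !inE => /or3P[]/eqP->.
  apply: (@low_nbrs_adj v); rewrite ?low //.
  - by apply: (@deg_ge7 x y z) => //; apply: offX esv.
  - by rewrite es.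
  - by rewrite vv es.
have [xX yX zX] : [/\ x \in [:: x; y; z], y \in [:: x; y; z] & z \in [:: x; y; z]].
  by rewrite !inE !eqxx !orbT.
move: (us); rewrite /= !inE negb_or andbT => /andP[/andP[xy xz] yz].
have ab : a != b by apply: ne exa eyb.
have ab' : a' != b by apply: ne exa' eyb.
have ac : a != c by apply: ne exa ezc.
have ac' : a' != c by apply: ne exa' ezc.
have bc : b != c by apply: ne eyb ezc.
apply: (@traceable_of_complete_off x y z) => //.
have offE u v : e u v -> complete_off [set x; y; z] e u v by rewrite /complete_off => ->.
apply: (@traceable_complete_off _ _ _ b [:: y] a [:: x; a'; c; z]) => //=.
- by rewrite offE // es.
- rewrite (offE a x) ?(es a) // (offE x a') // (offE c z) ?(es c) //= andbT.
  by rewrite /complete_off ac' aX' cX orbT.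
- move: aX aX' bX cX; rewrite !inE !negb_or -!andbA.
  move=> /and3P[ax ay az] /and3P[ax' ay' az'] /and3P[bx by_ bz] /and3P[cx cy cz].
  rewrite aa' ac ac' bc [b == a]eq_sym ab [b == a']eq_sym ab' ax az az' bx by_ bz cz.
  rewrite [x == a']eq_sym ax' [x == c]eq_sym cx xz [y == a]eq_sym ay [y == x]eq_sym xy.
  by rewrite [y == a']eq_sym ay' [y == c]eq_sym cy yz.
- by move=> w; rewrite !inE -orbA => /or3P[]->; rewrite ?orbT.
Qed.

(** The preceding two lemmas, under rotation of the three vertices, make them pairwise non-adjacent
    with one neighbour each; [low_nbrs_adj] makes these neighbours distinct. *)
Lemma three_pendants x y z :
  uniq [:: x; y; z] -> deg e x <= 2 -> deg e y <= 2 -> deg e z <= 2 ->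
  ~ traceable_rel e ->
  exists a b c, uniq [:: x; y; z; a; b; c] /\ pendants_attached e x y z a b c.
Proof.
move=> us dx dy dz nt.
have rot3 (p q r : T) : uniq [:: p; q; r] -> uniq [:: q; r; p].
  by move=> u; rewrite -(rot_uniq 2).
have us1 := rot3 _ _ _ us; have us2 := rot3 _ _ _ us1.
have nxy : ~~ e x y by apply/negP=> /(low_edge_traceable us dx dy dz).
have nyz : ~~ e y z by apply/negP=> /(low_edge_traceable us1 dy dz dx).
have nzx : ~~ e z x by apply/negP=> /(low_edge_traceable us2 dz dx dy).
have nyx : ~~ e y x by rewrite es.
have nzy : ~~ e z y by rewrite es.
have nxz : ~~ e x z by rewrite es.
have ux u v : e x u -> e x v -> u = v.
  move=> eu ev; apply: contra_notP nt => /eqP.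
  exact: (two_nbrs_traceable us dx dy dz nxy nxz nyz eu ev).
have uy u v : e y u -> e y v -> u = v.
  move=> eu ev; apply: contra_notP nt => /eqP.
  exact: (two_nbrs_traceable us1 dy dz dx nyz nyx nzx eu ev).
have uz u v : e z u -> e z v -> u = v.
  move=> eu ev; apply: contra_notP nt => /eqP.
  exact: (two_nbrs_traceable us2 dz dx dy nzx nzy nxy eu ev).
have /card_gt0P[a] := deg_gt0 x; rewrite inE => exa.
have /card_gt0P[b] := deg_gt0 y; rewrite inE => eyb.
have /card_gt0P[c] := deg_gt0 z; rewrite inE => ezc.
have offX s v : s \in [:: x; y; z] -> e s v -> v \notin [:: x; y; z].
  rewrite !inE => /or3P[]/eqP-> esv; apply: contraTN esv => /or3P[]/eqP->;
  by rewrite ?ei // es.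
have ne s s' v v' : s \in [:: x; y; z] -> s' \in [:: x; y; z] -> s != s' -> ~~ e s s' ->
    e s v -> e s' v' -> v != v'.
  move=> sX s'X ss' nss' esv es'v'; apply: contraNneq nss' => vv.
  have low w : w \in [:: x; y; z] -> deg e w <= 2 by rewrite !inE => /or3P[]/eqP->.
  apply: (@low_nbrs_adj v); rewrite ?low //.
  - by apply: (@deg_ge7 x y z) => //; have := offX _ _ sX esv; rewrite !inE orbA.
  - by rewrite es.
  - by rewrite vv es.
have [xX yX zX] : [/\ x \in [:: x; y; z], y \in [:: x; y; z] & z \in [:: x; y; z]].
  by rewrite !inE !eqxx !orbT.
move: (us); rewrite /= !inE negb_or andbT => /andP[/andP[xy xz] yz].
exists a, b, c; split.
  change (is_true (uniq ([:: x; y; z] ++ [:: a; b; c]))); rewrite cat_uniq us andTb.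
  apply/andP; split.
    apply/hasPn=> v vs; have : [|| v == a, v == b | v == c] by move: vs; rewrite !inE.
    case/or3P=> /eqP->.
    - exact: offX xX exa.
    - exact: offX yX eyb.
    - exact: offX zX ezc.
  rewrite /= !inE !negb_or andbT.
  by rewrite (ne _ _ _ _ xX yX xy nxy exa eyb) (ne _ _ _ _ xX zX xz nxz exa ezc)
    (ne _ _ _ _ yX zX yz nyz eyb ezc).
have pend s v : s \in [:: x; y; z] -> e s v ->
    (s, v) \in [:: (x, a); (y, b); (z, c)].
  by rewrite !inE => /or3P[]/eqP-> h;
   [rewrite (ux _ _ h exa)|rewrite (uy _ _ h eyb)|rewrite (uz _ _ h ezc)]; rewrite eqxx ?orbT.
have setE w : (w \in [set x; y; z]) = (w \in [:: x; y; z]) by rewrite !inE orbA.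
move=> u v euv; have evu : e v u by rewrite es.
rewrite !setE.
case: (boolP (u \in _)) => [/pend /(_ euv)|_] /=.
  by rewrite !inE => /or3P[]->; rewrite ?orbT.
case: (boolP (v \in _)) => [/pend /(_ evu)|_] //=.
by rewrite !inE !xpair_eqE => /or3P[]/andP[-> ->]; rewrite ?orbT.
Qed.

End ThreeLowDegree.

(** * Signless Laplacian eigenvalues *)

Local Open Scope ring_scope.

(** The equation (D + A)x = ax, coordinate by coordinate. The zero function satisfies it, so
    non-vanishing is always stated separately. *)
Definition is_eigenpair (R : realType) (G : sgraph) (x : G -> R) (a : R) : Prop :=
  forall v, \sum_(u | edge v u) (x v + x u) = a * x v.

Lemma row_signless_laplacian (R : realType) (G : sgraph) (w : 'rV[R]_#|G|) j :
  (w *m (degree_mx R G + adjacency_mx R G)) 0 j =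
  \sum_(u | edge (enum_val j) u) (w 0 j + w 0 (enum_rank u)).
Proof.
rewrite mulmxDr mxE mul_mx_diag !mxE big_split /=; congr (_ + _).
  by rewrite sumr_const mulr_natr /degree cardsE.
rewrite [RHS]big_mkcond /= [LHS](reindex enum_rank) /=; last exact/onW_bij/enum_rank_bij.
apply: eq_bigr => u _; rewrite mxE enum_rankK edge_sym.
by case: (edge _ _); rewrite ?mulr1 ?mulr0.
Qed.

Lemma eigenvalue_eigenpair (R : realType) (G : sgraph) (a : R) :
  eigenvalue (degree_mx R G + adjacency_mx R G) a <->
  exists x : G -> R, (exists v, x v != 0) /\ is_eigenpair x a.
Proof.
split.
  case/eigenvalueP=> w wE w0; exists (fun v => w 0 (enum_rank v)); split.
    case/rV0Pn: w0 => i wi; by exists (enum_val i); rewrite enum_valK.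
  move=> v; have := row_signless_laplacian w (enum_rank v).
  by rewrite wE mxE enum_rankK => <-.
case=> x [[v xv] xE]; apply/eigenvalueP; exists (\row_i x (enum_val i)).
  apply/rowP=> j; rewrite row_signless_laplacian !mxE -xE.
  by apply: eq_bigr => u _; rewrite mxE enum_rankK.
by apply/rV0Pn; exists (enum_rank v); rewrite mxE enum_rankK.
Qed.

Lemma eigenvalues_finite (R : realType) (G : sgraph) :
  exists s : seq R, forall a,
    eigenvalue (degree_mx R G + adjacency_mx R G) a -> a \in s.
Proof.
set A := _ + _; exists (rootsR (char_poly A)) => a.
rewrite eigenvalue_root_char => ra.
by rewrite -(roots_on_rootsR (monic_neq0 (char_poly_monic A))) in_itv /= ra.
Qed.

Lemma eigenvalue_le_q_index (R : realType) (G : sgraph) (a : R) :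
  eigenvalue (degree_mx R G + adjacency_mx R G) a -> a <= q_index R G.
Proof.
move=> ea; apply: ub_le_sup => //; have [s sP] := eigenvalues_finite R G.
by exists (\big[Order.max/0]_(x <- s) x) => x /= /sP xs; apply: le_bigmax_seq.
Qed.

(** Finiteness of the spectrum keeps the bound strict under the supremum. [sup] of the empty set is
    0, which [0 < b] covers. *)
Lemma q_index_lt (R : realType) (G : sgraph) (b : R) : 0 < b ->
  (forall a, eigenvalue (degree_mx R G + adjacency_mx R G) a -> a < b) ->
  q_index R G < b.
Proof.
move=> b0 H; have [s sP] := eigenvalues_finite R G.
rewrite /q_index; set E := classical_sets.mkset _.
have [->|/classical_sets.set0P ne] := eqVneq E classical_sets.set0; first by rewrite sup0.
apply: (@le_lt_trans _ _ (\big[Order.max/0]_(x <- s | x \in E) x)).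
  by apply: ge_sup => // x ex; apply: le_bigmax_seq; [apply: sP | apply: mem_set].
by apply: bigmax_lt => // x /set_mem; apply: H.
Qed.

(* Collatz-Wielandt: [M] is the set where |x| / y is maximal. *)
Lemma eigenpair_max_ratio (R : realType) (G : sgraph) (x y : G -> R) (a : R) :
  (forall v, 0 < y v) -> (exists v, x v != 0) -> is_eigenpair x a ->
  exists M : pred G, (exists v, M v) /\ forall v, M v ->
    a * y v <= \sum_(u | edge v u) (y v + y u) /\
    (\sum_(u | edge v u) (y v + y u) <= a * y v -> forall u, edge v u -> M u).
Proof.
move=> y0 [v0 xv0] xE.
have [v1 _ mx] := @arg_maxP _ _ _ v0 xpredT (fun v => `|x v| / y v) isT.
set t := `|x v1| / y v1 in mx.
have t0 : 0 < t.
  by apply: lt_le_trans (mx v0 isT); rewrite divr_gt0 // normr_gt0.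
have xle u : `|x u| <= t * y u by rewrite -ler_pdivrMr //; apply: mx.
exists (fun v => `|x v| == t * y v); split.
  by exists v1; rewrite /t divfK // gt_eqF.
move=> v /eqP xv.
have h1 : a * (t * y v) <= \sum_(u | edge v u) (`|x v| + `|x u|).
  rewrite -xv; apply: (le_trans (ler_norm _)); rewrite normrM normr_id -normrM -xE.
  by apply: (le_trans (ler_norm_sum _ _ _)); apply: ler_sum => u _; apply: ler_normD.
have h2 : \sum_(u | edge v u) (`|x v| + `|x u|) <= t * \sum_(u | edge v u) (y v + y u).
  by rewrite mulr_sumr; apply: ler_sum => u _; rewrite mulrDr xv lerD2l.
split.
  by rewrite -(ler_pM2l t0) mulrCA; apply: le_trans h1 h2.
move=> le u vu.
(* Under [le] the estimates [h1] and [h2] are equalities, so these nonnegative gaps all vanish. *)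
have : \sum_(u | edge v u) (t * y u - `|x u|) <= 0.
  have -> : \sum_(u | edge v u) (t * y u - `|x u|) =
      t * \sum_(u | edge v u) (y v + y u) - \sum_(u | edge v u) (`|x v| + `|x u|).
    by rewrite mulr_sumr -sumrB; apply: eq_bigr => w _; rewrite xv; ring.
  rewrite subr_le0; apply: le_trans _ h1; rewrite mulrCA ler_pM2l //.
have nn w : edge v w -> 0 <= t * y w - `|x w| by rewrite subr_ge0.
move=> s0; have {s0} : \sum_(u | edge v u) (t * y u - `|x u|) = 0.
  by apply/eqP; rewrite eq_le s0 sumr_ge0.
by move/(psumr_eq0P nn)=> /(_ _ vu) /eqP; rewrite subr_eq0 eq_sym.
Qed.

(** Outside its neighbourhood, [v] contributes d(v) to the total and each of the n - 1 - d(v) other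
    vertices at least 1. *)
Lemma sum_nbr_deg (G : sgraph) (v : G) : (forall u : G, (0 < deg (@edge G) u)%N) ->
  (\sum_(u | edge v u) deg (@edge G) u + #|G|.-1 <= \sum_u deg (@edge G) u)%N.
Proof.
move=> dpos; rewrite [leqRHS](bigID (@edge G v)) /= leq_add2l.
rewrite (bigD1 v) /=; last by rewrite edge_irrefl.
have h : (\sum_(u | ~~ edge v u && (u != v)) 1 <=
          \sum_(u | ~~ edge v u && (u != v)) deg (@edge G) u)%N.
  by apply: leq_sum => u _; apply: dpos.
apply: leq_trans (leq_add (leqnn _) h); rewrite sum1_card /deg.
rewrite -cardsT (cardsD1 v) in_setT add1n /=.
have := (leq_card_setU [set u | edge v u] [set u | ~~ edge v u && (u != v)]).1.
rewrite [X in _ -> (_ <= _ + X)%N](_ : _ = #|[set u | ~~ edge v u && (u != v)]|); last first.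
  by apply: eq_card => u; rewrite !inE.
apply: leq_trans; apply/subset_leq_card/subsetP=> u.
by rewrite !inE andbT => ->; case: (edge v u).
Qed.

(** This is q <= 2m/(n - 1) + n - 2 for m edges. Take the degrees as test vector: at a vertex of
    maximal ratio, a d <= d^2 + s with s the degree sum of its neighbours. *)
Lemma eigenpair_sum_deg (R : realType) (G : sgraph) (x : G -> R) (a : R) :
  (forall u : G, (0 < deg (@edge G) u)%N) -> (exists v, x v != 0) -> is_eigenpair x a ->
  (#|G|.-1)%:R * (a - (#|G|.-1)%:R + 1) <= (\sum_u deg (@edge G) u)%:R.
Proof.
move=> dpos x0 xE; set m := #|G|.-1.
have y0 v : 0 < (deg (@edge G) v)%:R :> R by rewrite ltr0n.
have [M [[v Mv] H]] := eigenpair_max_ratio y0 x0 xE.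
have {H} [h _] := H v Mv.
have dE : #|[pred u | edge v u]| = deg (@edge G) v by rewrite /deg cardsE.
rewrite big_split /= sumr_const dE -natr_sum -(mulr_natr (deg (@edge G) v)%:R) in h.
have dm w : (deg (@edge G) w <= m)%N.
  rewrite /deg /m -ltnS prednK; last by apply/card_gt0P; exists w.
  rewrite -cardsT (cardsD1 w [set: G]) in_setT add1n ltnS.
  apply/subset_leq_card/subsetP=> u; rewrite !inE andbT => wu.
  by apply: contraTneq wu => ->; rewrite edge_irrefl.
have := sum_nbr_deg v dpos; rewrite -/m -(ler_nat R) natrD.
set S := (\sum_u _)%N; set s := (\sum_(u | edge v u) deg _ u)%N in h * => hS.
have hs : s%:R <= (deg (@edge G) v)%:R * m%:R :> R.
  have : (s <= \sum_(u | edge v u) m)%N by apply: leq_sum => u _; apply: dm.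
  by rewrite sum_nat_const dE -natrM ler_nat.
have d1 : 1 <= (deg (@edge G) v)%:R :> R by rewrite ler1n.
have := dm v; rewrite -(ler_nat R) => dv.
move: h hS hs d1 dv; move: (deg _ _)%:R m%:R s%:R S%:R => d q s' S' h hS hs d1 dq.
have ad : a <= d + q.
  have d0 : 0 < d by lra.
  by rewrite -(ler_pM2r d0); lra.
(* Expanding this product turns a d - d^2 + q <= S into the claim; a <= d + q comes from s <= d
   q. *)
have : 0 <= (q - d) * (d + q - a) by apply: mulr_ge0; lra.
lra.
Qed.

(** * An explicit positive eigenvector of EN_n *)

Lemma sum_ord_lt (R : realType) (n m : nat) (c : R) : (m <= n)%N ->
  \sum_(j < n | (j < m)%N) c = m%:R * c.
Proof. by move=> mn; rewrite (big_ord_narrow mn) sumr_const card_ord mulr_natl. Qed.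

Lemma sum_EN_edge (R : realType) (n : nat) (F : 'I_n -> R) (i : 'I_n) : (6 <= n)%N ->
  \sum_(j | EN_edge i j) F j =
    if (i < n - 3)%N then \sum_(j < n | (j < n - 3)%N) F j - F i
                          + \sum_(j < n | j == (i + (n - 3))%N :> nat) F j
    else \sum_(j < n | i == (j + (n - 3))%N :> nat) F j.
Proof.
move=> n6; case: ifPn => iN.
  rewrite (bigID (fun j : 'I_n => (j < n - 3)%N)) /= [in RHS](bigD1 i) //= [F i + _]addrC addrK.
  congr (_ + _); apply: eq_bigl => j; rewrite /EN_edge iN -val_eqE /=.
    by rewrite andbC [in RHS]eq_sym; case: (ltnP j (n - 3)); rewrite //= andbT.
  by apply/idP/idP; lia.
apply: eq_bigl => j; rewrite /EN_edge -val_eqE /=; have := ltn_ord j; have := ltn_ord i.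
by move: iN; case: i => i /= _; case: j => j /= _; lia.
Qed.

(* The term 3 / (n - 1) is what makes 2m >= (n-1)(q-n+2) beat (n-2)(n-5) - 1. *)
Lemma EN_eigenpair (R : realType) (n : nat) : (18 <= n)%N ->
  exists (y : EN n -> R) (b : R), [/\ forall i, 0 < y i, is_eigenpair y b &
    2 * n%:R - 8 + 3 / (n%:R - 1) < b].
Proof.
move=> n18; have n6 : (6 <= n)%N by apply: leq_trans n18.
(* [N] is the order of the clique, so n - 1 = N + 2. *)
pose N : R := (n - 3)%:R.
have nE : n%:R = N + 3 :> R by rewrite /N natrB ?subrK //; lia.
have N15 : 15 <= N by rewrite /N ler_nat; lia.
pose c := 2 * n%:R - 8 + 3 / (n%:R - 1) : R.
pose eps : R := 3 / (n%:R - 1).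
have epsE : eps * (N + 2) = 3 by rewrite /eps nE; field; lra.
have cE : c = 2 * N - 2 + eps by rewrite /c -/eps nE; ring.
have eps0 : 0 < eps by rewrite /eps divr_gt0 //; lra.
have eps1 : eps < 1 by rewrite /eps ltr_pdivrMr; lra.
clearbody eps.
(* Up to sign, the characteristic polynomial of the quotient matrix of the
   partition into pendant, attached and remaining vertices. *)
pose p : {poly R} := (('X - (N + 2)%:P) * ('X - 1%:P) - 1%:P) * ('X - (2 * N - 5)%:P)
                     - (3 * (N - 3))%:P * ('X - 1%:P).
have pE x : p.[x] = ((x - (N + 2)) * (x - 1) - 1) * (x - (2 * N - 5)) - 3 * (N - 3) * (x - 1).
  by rewrite /p !hornerE.
(* [eps] is chosen so that eps (N + 2) - 3 vanishes. The sign change between [c] and [2 * N + 1]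
   then provides a root above [c]. *)
have pc : p.[c] < 0.
  have -> : p.[c] = (2 * N - 3 + eps) * (eps * (N + 2) - 3 - (3 - eps) * eps) - 3 - eps.
    by rewrite pE cE; ring.
  rewrite epsE subrr sub0r.
  have : 0 < (2 * N - 3 + eps) * ((3 - eps) * eps) by do ?apply: mulr_gt0; lra.
  lra.
(* A convenient upper end: the factor X - (2N - 5) is 6 there. *)
have pd : 0 <= p.[2 * N + 1].
  have -> : p.[2 * N + 1] = 6 * (N * N + N - 1) by rewrite pE; ring.
  have : 0 <= N * N by apply: mulr_ge0; lra.
  lra.
have cd : c <= 2 * N + 1 by rewrite cE; lra.
have [|b /andP[cb _] /eqP pb] := @poly_ivt R p c (2 * N + 1) cd; first by rewrite ltW.
have {}cb : c < b by rewrite lt_neqAle cb andbT; apply: contraTneq pc => ->; rewrite pb ltxx.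
have b2N : 2 * N - 2 < b by rewrite cE in cb; lra.
(* With value 1 on pendant vertices, their equation forces b - 1 on attached ones, and the equation
   at a remaining vertex, (2N - 5)g + 3(b - 1) = bg, forces [g]. *)
pose g := 3 * (b - 1) / (b - (2 * N - 5)).
have gE : g * (b - (2 * N - 5)) = 3 * (b - 1) by rewrite /g divfK //; apply/eqP; lra.
(* The equation at an attached vertex; it holds because [b] is a root of [p]. *)
have gE2 : (b - (N + 2)) * (b - 1) - 1 = (N - 3) * g.
  apply: (@mulIf _ (b - (2 * N - 5))); first by apply/eqP; lra.
  by rewrite -[RHS]mulrA gE; move: pb; rewrite pE; lra.
pose y (i : EN n) : R := if (i < 3)%N then b - 1 else if (i < n - 3)%N then g else 1.
exists y, b; split=> // [i|i].
  rewrite /y; case: ifP => _; first lra.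
  by case: ifP => _ //; rewrite /g divr_gt0 //; lra.
rewrite [LHS](@sum_EN_edge _ _ (fun j => y i + y j) i n6).
have sy : \sum_(j < n | (j < n - 3)%N) (y i + y j) = N * y i + (N * g + 3 * (b - 1 - g)).
  rewrite big_split /= sum_ord_lt; last by lia.
  congr (_ + _).
  rewrite (eq_bigr (fun j : 'I_n => g + (if (j < 3)%N then b - 1 - g else 0))); last first.
    by move=> j jN; rewrite /y jN; case: ifP => _; ring.
  rewrite big_split /= sum_ord_lt; last by lia.
  congr (_ + _); rewrite -big_mkcondr /= (eq_bigl (fun j : 'I_n => (j < 3)%N)) ?sum_ord_lt //.
    by lia.
  by move=> j; rewrite /= ; lia.
rewrite sy; case: ifPn => iN.
  case: (ltnP i 3) => i3.
    have iN3 : (i + (n - 3) < n)%N by lia.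
    rewrite (big_pred1 (Ordinal iN3)); last by [].
    have -> : y i = b - 1 by rewrite /y i3.
    have -> : y (Ordinal iN3) = 1 by rewrite /y /= !ifN //; lia.
    by move: gE2; lra.
  rewrite big_pred0 => [|j]; last by have := ltn_ord j; lia.
  have -> : y i = g by rewrite /y iN ltnNge i3.
  by move: gE; lra.
have iN3 : (i - (n - 3) < n)%N by apply: leq_ltn_trans (leq_subr _ _) (ltn_ord i).
rewrite (big_pred1 (Ordinal iN3)); last first.
  by move=> j; rewrite /= -(inj_eq val_inj) /=; lia.
have -> : y i = 1 by rewrite /y (negbTE iN) ifN //; lia.
have -> : y (Ordinal iN3) = b - 1 by rewrite /y /= ifT //; have := ltn_ord i; lia.
by ring.
Qed.

(** Pulled back to [G], [y] loses neighbours, so its ratio is at most b <= a everywhere. The set of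
    maximal ratio is then closed under adjacency, hence everything, and an edge missing in [G] would
    give a < b at its ends. *)
Lemma eigenpair_hom_lt (R : realType) (G H : sgraph) (f : G -> H) (x : G -> R) (y : H -> R) a b :
  connected_graph G -> bijective f -> (forall u v, edge u v -> edge (f u) (f v)) ->
  (forall v, 0 < y v) -> is_eigenpair y b -> (exists v, x v != 0) -> is_eigenpair x a ->
  b <= a -> graph_iso G H.
Proof.
move=> con bf hf y0 yE x0 xE ba; exists f; split=> //.
have [M [[v0 Mv0] HM]] := eigenpair_max_ratio (fun v => y0 (f v)) x0 xE.
have sE v : \sum_(u | edge (f v) (f u)) (y (f v) + y (f u)) = b * y (f v).
  by rewrite -yE [RHS](reindex f) //; apply: onW_bij.
have ls v : \sum_(u | edge v u) (y (f v) + y (f u)) <= b * y (f v).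
  rewrite -sE big_mkcond [leRHS]big_mkcond; apply: ler_sum => u _.
  case: (boolP (edge v u)) => [/hf->//|_]; case: ifP => // _.
  by rewrite addr_ge0 // ltW.
have bay v : b * y (f v) <= a * y (f v) by rewrite ler_pM2r.
have allM v : M v.
  have Mcl : closed (@edge G) M.
    apply: intro_closed; first exact/sym_connect_sym/edge_sym.
    by move=> u w uw uM; apply: (HM u uM).2 uw; apply: le_trans (ls u) (bay u).
  have := closed_connect Mcl (con v0 v).
  by rewrite /in_mem /= Mv0 => /esym.
move=> u v; apply/idP/idP; last exact: hf.
move=> fuv; apply: contraT => nuv.
have [h _] := HM u (allM u).
have : \sum_(w | edge u w) (y (f u) + y (f w)) + (y (f u) + y (f v)) <= b * y (f u).
  rewrite -sE [leRHS](bigD1 v) //= [leLHS]addrC lerD2l big_mkcond [leRHS]big_mkcond.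
  apply: ler_sum => w _; case: (boolP (edge u w)) => [uw|_].
    by rewrite (hf _ _ uw) /=; case: eqVneq uw nuv => // -> ->.
  by case: ifP => // _; rewrite addr_ge0 // ltW.
by have := y0 (f u); have := y0 (f v); have := bay u; lra.
Qed.

(** * Comparison with EN_n *)

(** The vertices are listed as a, b, c, then the others, then x, y, z, and each is sent to its
    index: this matches the numbering of [EN n], where n - 3, n - 2, n - 1 hang on 0, 1, 2. *)
Lemma EN_hom (G : sgraph) (n : nat) (x y z a b c : G) :
  #|G| = n -> uniq [:: x; y; z; a; b; c] -> pendants_attached (@edge G) x y z a b c ->
  exists f : G -> EN n, bijective f /\ forall u v, edge u v -> edge (f u) (f v).
Proof.
move=> cG us att.
pose l1 := [:: a; b; c] ++ [seq w <- enum G | w \notin [:: x; y; z; a; b; c]].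
pose l := l1 ++ [:: x; y; z].
have perm : perm_eq l (enum G).
  rewrite /l /l1 perm_catC catA -[[:: x; y; z] ++ _]/([:: x; y; z; a; b; c]).
  apply: uniq_perm; rewrite ?enum_uniq //.
    rewrite cat_uniq us filter_uniq ?enum_uniq // andbT.
    by apply/hasPn=> w; rewrite mem_filter => /andP[].
  move=> w; have wG : w \in enum G by rewrite mem_enum.
  by rewrite mem_cat mem_filter wG andbT orbN.
have fl w : w \in l by rewrite (perm_mem perm) mem_enum.
have ul : uniq l by rewrite (perm_uniq perm) enum_uniq.
have sl : size l = n by rewrite (perm_size perm) -cardE.
have sl1 : size l1 = (n - 3)%N by rewrite -sl /l size_cat addnK.
have lt w : (index w l < n)%N by rewrite -sl index_mem.
pose f w : EN n := Ordinal (lt w).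
have finj : injective f.
  move=> u v fuv; have h : index u l = index v l := congr1 val fuv.
  by rewrite -(nth_index u (fl u)) h nth_index.
exists f; split; first by apply: inj_card_bij; rewrite // card_ord cG.
have n6 : (6 <= n)%N by rewrite -cG -[6%N]/(size [:: x; y; z; a; b; c]) -(card_uniqP us) max_card.
have fX w : w \notin [set x; y; z] -> (index w l < n - 3)%N.
  rewrite !inE !negb_or -andbA => /and3P[wx wy wz].
  have wl : w \in l1.
    by have := fl w; rewrite /l mem_cat !inE (negbTE wx) (negbTE wy) (negbTE wz) !orbF.
  by rewrite /l index_cat wl -sl1 index_mem.
have [[xy xz yz] [ab ac bc]] :
    [/\ x != y, x != z & y != z] /\ [/\ a != b, a != c & b != c].
  by move: us; rewrite /= !inE !negb_or -!andbA; do !case/andP=> ?; split.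
have out w : w \in [:: x; y; z] -> index w l = (n - 3 + index w [:: x; y; z])%N.
  move=> wX; rewrite /l index_cat -sl1 ifN // /l1 mem_cat mem_filter negb_or.
  have -> : w \in [:: x; y; z; a; b; c].
    by move: wX; rewrite !inE => /or3P[]->; rewrite ?orbT.
  rewrite andbT; move: us; rewrite (cat_uniq [:: x; y; z] [:: a; b; c]) => /and3P[_ /hasPn H _].
  by apply: contraL wX; apply: H.
have fa : index a l = 0%N by rewrite /= eqxx.
have fb : index b l = 1%N by rewrite /= (negbTE (_ : a != b)) ?eqxx.
have fc : index c l = 2%N.
  by rewrite /= (negbTE (_ : a != c)) // (negbTE (_ : b != c)) ?eqxx.
have fx : index x l = (n - 3)%N by rewrite out /= ?inE eqxx ?addn0.
have fy : index y l = (n - 3 + 1)%N.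
  by rewrite out ?inE ?eqxx ?orbT //= (negbTE (_ : x != y)) ?eqxx.
have fz : index z l = (n - 3 + 2)%N.
  by rewrite out ?inE ?eqxx ?orbT //= (negbTE (_ : x != z)) // (negbTE (_ : y != z)) ?eqxx.
clearbody l; have fE w : f w = index w l :> nat by [].
move=> u v uv; change (EN_edge (f u) (f v)); rewrite /EN_edge (inj_eq finj) !fE.
have -> : u != v by apply: contraTneq uv => ->; rewrite edge_irrefl.
rewrite andTb; case/orP: (att u v uv) => [/andP[/fX-> /fX->]//|].
rewrite !inE !xpair_eqE => h; apply/orP; right.
by case/or4P: h => [|||/or3P[]] /andP[/eqP-> /eqP->];
   rewrite ?fa ?fb ?fc ?fx ?fy ?fz; clear; lia.
Qed.

Lemma claw_free_relP (G : sgraph) : claw_free G -> claw_free_rel (@edge G).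
Proof.
move=> cf u x y z ux uy uz xy xz yz; apply: contraT; rewrite !negb_or => /and3P[nxy nxz nyz].
have ne w : edge u w -> u != w by apply: contraTneq => <-; rewrite edge_irrefl.
pose s := [:: x; y; z].
have us : uniq s by rewrite /= !inE negb_or xy xz yz.
have sE (i : 'I_3) : nth u s i \in s by rewrite mem_nth.
have su w : w \in s -> edge u w by rewrite !inE => /or3P[]/eqP->.
have ss w w' : w \in s -> w' \in s -> edge w w' = false.
  by rewrite !inE => /or3P[]/eqP-> /or3P[]/eqP->; rewrite ?edge_irrefl //; apply/negbTE;
     first [done | rewrite edge_sym].
case: cf; exists (fun k : complete_bipartite 1 3 =>
  match k with inl _ => u | inr i => nth u s i end); split.
  case=> [i|i] [j|j] //= h.
  - by rewrite !ord1.
  - by have := ne _ (su _ (sE j)); rewrite -h eqxx.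
  - by have := ne _ (su _ (sE i)); rewrite h eqxx.
  - have := @nth_uniq _ u s i j (ltn_ord i) (ltn_ord j) us.
    by rewrite h eqxx => /esym/eqP/val_inj->.
case=> [i|i] [j|j]; rewrite /= /Kb_edge /=.
- exact: edge_irrefl.
- exact/su/sE.
- by rewrite edge_sym; apply/su/sE.
- exact: ss.
Qed.

Theorem theorem6 (R : realType) (n : nat) (G : sgraph)
    (card_G : #|G| = n) (n_ge18 : (18 <= n)%N)
    (conn_G : connected_graph G) (claw_free_G : claw_free G)
    (q_ge : (q_index R (EN n) <= q_index R G)%R) :
  ~ graph_iso G (EN n) -> traceable G.
Proof.
move=> niso; apply: contrapT => nt.
have es := @edge_sym G; have ei := @edge_irrefl G.
have cf := claw_free_relP claw_free_G.
have [y [b [y0 yE blt]]] := EN_eigenpair R n_ge18.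
have n18 : 18 <= n%:R :> R by rewrite ler_nat.
have b0 : 0 < b.
  apply: lt_trans blt; have : 0 < 3 / (n%:R - 1) :> R by rewrite divr_gt0 //; lra.
  by move: n18; lra.
have n0 : (0 < n)%N by apply: leq_trans n_ge18.
have eb : eigenvalue (degree_mx R (EN n) + adjacency_mx R (EN n)) b.
  apply/eigenvalue_eigenpair; exists y; split=> //.
  by exists (Ordinal n0); rewrite gt_eqF.
(* If all eigenvalues of [G] were below [b], so would be its [q_index], although [b] is at most that
   of [EN n]. *)
have [a ea ba] : exists2 a, eigenvalue (degree_mx R G + adjacency_mx R G) a & b <= a.
  apply: contrapT => H; have := le_trans (eigenvalue_le_q_index eb) q_ge.
  rewrite leNgt q_index_lt // => a ea; rewrite ltNge; apply/negP=> ba.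
  by apply: H; exists a.
case/eigenvalue_eigenpair: ea => x [x0 xE].
have dpos (u : G) : (0 < deg (@edge G) u)%N.
  by apply: connected_deg_gt0 => //; rewrite card_G; lia.
have sumd : ((n - 2) * (n - 5) <= \sum_u deg (@edge G) u)%N.
  have := eigenpair_sum_deg dpos x0 xE; rewrite card_G.
  set S := (\sum_u _)%N; have -> : n.-1%:R = n%:R - 1 :> R by rewrite -subn1 natrB.
  (* The bound (n - 1)(n - 6) + 3 equals (n - 2)(n - 5) - 1, so integrality of the degree sum closes
     the gap. *)
  move=> h; have {h} : (n%:R - 1) * (n%:R - 6) + 3 < S%:R :> R.
    apply: lt_le_trans h.
    have idn (t : R) : 18 <= t ->
        (t - 1) * (t - 6) + 3 = (t - 1) * ((2 * t - 8 + 3 / (t - 1)) - (t - 1) + 1).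
      by clear => t18; field; lra.
    rewrite idn // ltr_pM2l ?ltrD2r; first exact: lt_le_trans blt ba.
    by move: n18; clear; lra.
  have -> : (n%:R - 1) * (n%:R - 6) + 3 = ((n - 1) * (n - 6) + 3)%N%:R :> R.
    by rewrite natrD natrM !natrB //; lia.
  rewrite ltr_nat; have [k ->] : exists k, n = (k + 6)%N by exists (n - 6)%N; lia.
  by lia.
have [p [q [r [us dp dq dr]]]] := three_low_degree es ei cf conn_G card_G n_ge18 sumd nt.
have [a' [b' [c' [us' att]]]] :=
  three_pendants es ei cf conn_G card_G n_ge18 sumd us dp dq dr nt.
have [f [bf hf]] := EN_hom card_G us' att.
exact/niso/(eigenpair_hom_lt conn_G bf hf y0 yE x0 xE ba).
Qed.
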